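(* Let $G$ be a $\lambda''$-connected super-$\lambda'$ graph. Write $\lambda''=\lambda''(G)$, $\xi=\xi(G)$ and $\delta=\delta(G)$ (the minimum vertex-degree of $G$). Then (i) $\rho'(G)\geqslant \min\{\lambda''-\xi-1,\ \delta-1\}$ if $\eta(G)\geqslant \delta$; (ii) $\rho'(G)\geqslant \min\{\lambda''-\xi,\ \delta-1\}$ if $G$ is edge-regular.
   Context: All graphs are finite and simple. For a connected graph $G=(V,E)$ and an integer $h\geqslant 0$, a set $F\subseteq E(G)$ is an $h$-extra edge-cut if $G-F$ is disconnected and every component of $G-F$ has more than $h$ vertices. If such a set exists, $\lambda^{(h)}(G)$ is the minimum cardinality of an $h$-extra edge-cut, and $G$ is called $\lambda^{(h)}$-connected. A $\lambda^{(h)}$-cut is an $h$-extra edge-cut of cardinality $\lambda^{(h)}(G)$. Write $\lambda'=\lambda^{(1)}$ and $\lambda''=\lambda^{(2)}$. For an edge $xy$ of $G$, its edge-degree is $d_G(\{x,y\})=d_G(x)+d_G(y)-2$; $\xi(G)$ is the minimum edge-degree of $G$, $\eta(G)$ is the number of edges of $G$ with edge-degree $\xi(G)$, and $G$ is edge-regular if every edge of $G$ has edge-degree $\xi(G)$. A $\lambda'$-connected graph $G$ is super-$\lambda'$ if $\lambda'(G)=\xi(G)$ and, for every $\lambda'$-cut $F$ of $G$, some component of $G-F$ has exactly $2$ vertices. A disconnected graph is not super-$\lambda'$. For a super-$\lambda'$ graph $G$, the persistence $\rho'(G)$ is the maximum integer $m$ such that $G-F$ is still super-$\lambda'$ for every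 $F\subseteq E(G)$ with $|F|\leqslant m$. *)

(* Defs.v *)
From mathcomp Require Import all_boot.

Set Implicit Arguments.
Unset Strict Implicit.
Unset Printing Implicit Defensive.

(* A finite simple graph is a vertex type [T] together with its edge set
   [E : {set {set T}}], all of whose members have two elements.  The graph
   [G - F] is then the one with edge set [E :\: F], on the same vertices. *)

Section Graph.

Variable T : finType.
Implicit Types (E F : {set {set T}}) (e : {set T}) (x : T) (h m : nat).

Definition simple_graph E : bool := [forall e in E, #|e| == 2].

Definition adj E : rel T := fun x y => [set x; y] \in E.

Definition component E x : {set T} := [set y | connect (adj E) x y].

Definition components E : {set {set T}} := [set component E x | x : T].

Definition connected E : bool := #|components E| == 1.

Definition degree E x : nat := #|[set e in E | x \in e]|.

(* The minima below are big [minn]s whose default value bounds from above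
   every term of the range: they are the true minima as soon as the range is
   nonempty (the value on an empty range is irrelevant). *)

Definition min_degree E : nat := \big[minn/#|E|]_(x : T) degree E x.

(* The subtraction never truncates when [e] is an edge of a simple graph. *)
Definition edge_degree E e : nat := (\sum_(x in e) degree E x) - 2.

Definition xi E : nat := \big[minn/#|E|.*2]_(e in E) edge_degree E e.

Definition eta E : nat := #|[set e in E | edge_degree E e == xi E]|.

Definition edge_regular E : bool :=
  [forall e in E, edge_degree E e == xi E].

Definition extra_edge_cut h E F : bool :=
  [&& F \subset E, ~~ connected (E :\: F)
    & [forall C in components (E :\: F), h < #|C|]].

Definition lambda_connected h E : bool :=
  connected E && [exists F : {set {set T}}, extra_edge_cut h E F].

Definition lambda h E : nat :=
  \big[minn/#|E|]_(F : {set {set T}} | extra_edge_cut h E F) #|F|.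

Definition lambda_cut h E F : bool :=
  extra_edge_cut h E F && (#|F| == lambda h E).

Definition super_lambda' E : bool :=
  [&& lambda_connected 1 E, lambda 1 E == xi E
    & [forall F : {set {set T}}, lambda_cut 1 E F ==>
      [exists C in components (E :\: F), #|C| == 2]]].

Definition persistent m E : bool :=
  [forall F : {set {set T}},
    (F \subset E) && (#|F| <= m) ==> super_lambda' (E :\: F)].

(* Only [m <= #|E|] need be considered: the edgeless graph [E :\: E] is not
   super-lambda', so [persistent m E] fails for every [m >= #|E|]. *)
Definition rho' E : nat := \max_(m < #|E|.+1 | persistent m E) m.

End Graph.

(* Main.v *)
(* Deleting [F] cannot disconnect [G], since a minimal edge-cut of [G] has at
   least [min (delta, lambda') >= delta] edges.  A [lambda']-cut of [H = G - F]
   can be taken to be a bond, which is also a bond of [G].  If both of its sides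
   have at least three vertices, it has at least [lambda'' - |F|] edges, and this
   exceeds [xi(H)]: in (i) some edge of edge-degree [xi(G)] survives, so that
   [xi(H) <= xi(G)]; in (ii) any edge of [H] adjacent to a deleted one shows that
   [xi(H) < xi(G)].  Otherwise the bond isolates an edge, and so has at least
   [xi(H)] edges. *)

Require Import Defs.
From mathcomp Require Import all_boot all_order all_algebra.
From mathcomp Require Import zify.

Set Implicit Arguments.
Unset Strict Implicit.
Unset Printing Implicit Defensive.

Import Order.TTheory.

Section Graph.

Variable T : finType.
Implicit Types (E F H : {set {set T}}) (e C D : {set T}) (x y z : T) (h m : nat).

(** * Connectivity, and the minima as bounds *)

Lemma adj_sym E : symmetric (adj E).
Proof. by move=> x y; rewrite /adj setUC. Qed.

Lemma connect_adj_sym E : connect_sym (adj E).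
Proof. exact/sym_connect_sym/adj_sym. Qed.

Lemma connect_adjS E H x y :
  E \subset H -> connect (adj E) x y -> connect (adj H) x y.
Proof.
by move=> EH; apply: connect_sub => u v uv; apply/connect1/(subsetP EH).
Qed.

Lemma connectedP E :
  reflect (0 < #|T| /\ forall x y, connect (adj E) x y) (connected E).
Proof.
apply: (iffP cards1P) => [[C EC] | [/card_gt0P[x0 _] conn]].
  have [x xC] : exists x, x \in T.
    have : C \in components E by rewrite EC set11.
    by case/imsetP=> x _ _; exists x.
  split=> [|u v]; first by apply/card_gt0P; exists x.
  have comp w : component E w = C.
    by apply/set1P; rewrite -EC; apply: imset_f.
  have : v \in component E v by rewrite inE connect0.
  by rewrite comp -(comp u) inE.
exists setT; apply/setP => C; rewrite in_set1; apply/imsetP/eqP => [[x _ ->]|->].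
  by apply/setP => y; rewrite !inE conn.
by exists x0 => //; apply/setP => y; rewrite !inE conn.
Qed.

Lemma min_degree_leq E x : min_degree E <= degree E x.
Proof. rewrite /min_degree -minEnat -leEnat; exact: bigmin_le. Qed.

Lemma xi_leq E e : e \in E -> xi E <= edge_degree E e.
Proof. rewrite /xi -minEnat -leEnat; exact: bigmin_le_cond. Qed.

Lemma lambda_leq h E F : extra_edge_cut h E F -> lambda h E <= #|F|.
Proof. rewrite /lambda -minEnat -leEnat; exact: bigmin_le_cond. Qed.

Lemma leq_lambda h E m :
    m <= #|E| -> (forall F, extra_edge_cut h E F -> m <= #|F|) ->
  m <= lambda h E.
Proof. rewrite /lambda -minEnat -leEnat; exact: le_bigmin. Qed.

Lemma degree_leq_edges E x : degree E x <= #|E|.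
Proof. by apply/subset_leq_card/subsetP => e; rewrite inE => /andP[]. Qed.

Lemma xi_attained E :
  simple_graph E -> E != set0 -> exists2 e, e \in E & edge_degree E e = xi E.
Proof.
move=> /forall_inP sE /set0Pn[e0 e0E].
case: (arg_minnP (edge_degree E) e0E) => e eE le_e; exists e => //.
apply/eqP; rewrite eqn_leq xi_leq // andbT /xi -minEnat -leEnat.
(* The default value is harmless: both ends of an edge have degree at most [#|E|]. *)
apply: le_bigmin => //; rewrite leEnat.
move/sE/eqP: eE => e2; apply: leq_trans (leq_subr _ _) _.
rewrite -mul2n -e2 -sum_nat_const; apply: leq_sum => x _.
exact: degree_leq_edges.
Qed.

Lemma simple_graphS E H : E \subset H -> simple_graph H -> simple_graph E.
Proof.
by move=> /subsetP EH /forall_inP sH; apply/forall_inP => e /EH/sH.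
Qed.

Lemma simple_graph_edge E e :
  simple_graph E -> e \in E -> exists x y, x != y /\ e = [set x; y].
Proof. by move=> /forall_inP sE /sE/cards2P[x [y]]; exists x, y. Qed.

Lemma adj_neq E x y : simple_graph E -> adj E x y -> x != y.
Proof. by move=> /forall_inP sE /sE; rewrite cards2; case: (x != y). Qed.

(** * Cuts around vertex sets, and bonds *)

Definition cut E D : {set {set T}} :=
  [set e in E | ~~ (e \subset D) && ~~ (e \subset ~: D)].

Lemma cut_sub E D : cut E D \subset E.
Proof. by apply/subsetP => e; rewrite inE => /andP[]. Qed.

Lemma cutC E D : cut E (~: D) = cut E D.
Proof. by apply/setP => e; rewrite !inE setCK [~~ _ && ~~ _]andbC. Qed.

Lemma adjD_cut E D x y :
  adj (E :\: cut E D) x y = adj E x y && ((x \in D) == (y \in D)).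
Proof.
rewrite /adj !inE !subUset !sub1set !inE andbC.
by case: (_ \in E) => //=; case: (x \in D); case: (y \in D).
Qed.

Lemma connectD_cut E D x y :
  connect (adj (E :\: cut E D)) x y -> (x \in D) = (y \in D).
Proof.
case/connectP => p + ->; elim: p x => //= u p IH x /andP[].
by rewrite adjD_cut => /andP[_ /eqP->] /IH.
Qed.

Lemma component_uncut E H x :
  simple_graph H -> H \subset E -> H \subset E :\: cut E (component H x).
Proof.
move=> sH HE; apply/subsetP => e eH.
have [u [v [_ e_uv]]] := simple_graph_edge sH eH; rewrite e_uv in eH *.
suff : adj (E :\: cut E (component H x)) u v by [].
have xuv : connect (adj H) x u = connect (adj H) x v.
  by apply: (same_connect_r (@connect_adj_sym H)); apply: connect1.
by rewrite adjD_cut /adj (subsetP HE) //= !inE xuv.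
Qed.

(* Edges outside [cut E D] never change sides, so this says that both [D] and its
   complement induce connected subgraphs. *)
Definition bond E D : Prop :=
  forall x y, (x \in D) = (y \in D) -> connect (adj (E :\: cut E D)) x y.

Lemma bondC E D : bond E D -> bond E (~: D).
Proof. by move=> bD x y; rewrite cutC !inE => /negb_inj/bD. Qed.

Lemma cutS E H D : E \subset H -> E :\: cut E D \subset H :\: cut H D.
Proof.
move=> /subsetP EH; apply/subsetP => e; rewrite !inE => /andP[+ eE].
by rewrite eE (EH e eE) andbT.
Qed.

(** New edges inside a side keep it connected; this turns bonds of [G - F] into bonds of [G]. *)
Lemma bondS E H D : E \subset H -> bond E D -> bond H D.
Proof.
by move=> EH bD x y /bD; apply: connect_adjS; apply: cutS.
Qed.

Lemma bond_component E D x :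
  bond E D -> component (E :\: cut E D) x = if x \in D then D else ~: D.
Proof.
move=> bD; apply/setP => y; rewrite inE; apply/idP/idP.
  by move=> /connectD_cut xy; case: ifP => xD; rewrite ?inE -xy xD.
move=> yD; apply: bD; move: yD; case: ifP => xD; first by move->.
by rewrite inE => /negPf->.
Qed.

(** The two sides of a bond are the only components left, so only their sizes matter. *)
Lemma bond_extra_cut h E D :
  h < #|D| -> h < #|~: D| -> bond E D -> extra_edge_cut h E (cut E D).
Proof.
move=> hD hDC bD; rewrite /extra_edge_cut cut_sub /=; apply/andP; split.
  have /card_gt0P[x xD] : 0 < #|D| by lia.
  have /card_gt0P[y] : 0 < #|~: D| by lia.
  rewrite inE => yD; apply/negP => /connectedP[_ /(_ x y)] /connectD_cut.
  by rewrite xD (negPf yD).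
apply/forall_inP => C /imsetP[x _ ->]; rewrite bond_component //.
by case: ifP.
Qed.

(* Removing a component [C] of [E :\: F] splits the rest of the connected graph
   [E] into pieces, each of which is attached to [C]; any of these is a bond. *)
Lemma extra_cut_bond h E F :
    simple_graph E -> connected E -> extra_edge_cut h E F ->
  exists D, [/\ h < #|D|, h < #|~: D|, bond E D & cut E D \subset F].
Proof.
move=> sE /connectedP[T_gt0 connE] /and3P[FE disc /forall_inP big].
set H := E :\: F in disc big *.
have HE : H \subset E by apply: subsetDl.
have [x [y nxy]] : exists x y, ~~ connect (adj H) x y.
  suff /existsP[x /existsP[y]] : [exists x, exists y, ~~ connect (adj H) x y].
    by exists x, y.
  apply: contraNT disc => /existsPn conn.
  apply/connectedP; split=> // u v.
  by have /existsPn/(_ v) := conn u; rewrite negbK.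
have sH := simple_graphS HE sE.
(* [D] is the piece of [y] once [C] is detached; it absorbs the whole [H]-component of [y]. *)
set C := component H x; set H' := E :\: cut E C; set D := component H' y.
have HH' : H \subset H' by apply: component_uncut.
have H'E : H' \subset E by apply: subsetDl.
have H'D : H' \subset E :\: cut E D.
  exact/component_uncut/H'E/(simple_graphS H'E).
have HD := subset_trans HH' H'D.
have yC : y \notin C by rewrite inE.
have CD u : u \in C -> u \notin D.
  by move=> uC; rewrite inE; apply: contra yC => /connectD_cut ->.
exists D; split.
- apply: leq_trans (big (component H y) _) _; first exact: imset_f.
  by apply/subset_leq_card/subsetP => u; rewrite !inE; apply: connect_adjS.
- apply: leq_trans (big C _) _; first exact: imset_f.
  by apply/subset_leq_card/subsetP => u /CD; rewrite in_setC.
- have connC u : u \in C -> connect (adj (E :\: cut E D)) u x.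
    by rewrite inE connect_adj_sym; apply: connect_adjS.
  (* Until a walk from [u] to [x] meets [C], it cannot enter [D]: an edge avoiding [C] stays within
     one component of [H']. *)
  have connDC u : u \notin D -> connect (adj (E :\: cut E D)) u x.
    have /connectP[p Ep p_x] := connE u x.
    elim: p u Ep p_x => [|w p IH] u /= => [_ <-|/andP[uw wp] p_x] uD.
      exact: connect0.
    have [/connC//|uC] := boolP (u \in C).
    have wD : w \notin D.
      have [/CD//|wC] := boolP (w \in C).
      apply: contra uD; rewrite !inE => yw; apply: connect_trans yw _.
      apply: connect1; rewrite adj_sym adjD_cut uw.
      by rewrite (negPf uC) (negPf wC).
    apply: connect_trans (IH w wp p_x wD); apply: connect1.
    by rewrite adjD_cut uw (negPf uD) (negPf wD).
  move=> u v; have [uD /esym vD|uD /esym/negbT vD] := boolP (u \in D).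
    apply: connect_adjS H'D _; rewrite !inE in uD vD.
    by apply: connect_trans vD; rewrite connect_adj_sym.
  apply: connect_trans (connDC u uD) _.
  by rewrite connect_adj_sym connDC.
- apply/subsetP => e eD; have eE := subsetP (cut_sub E D) e eD.
  apply/negPn/negP => eF; have /(subsetP HD) : e \in H by rewrite inE eF.
  by rewrite inE eD.
Qed.

(** A neighbour on the same side survives the cut, so no component is a single vertex. *)
Lemma extra_cut1 E D :
    D != set0 -> ~: D != set0 ->
    (forall x, exists y, [/\ x != y, adj E x y & (x \in D) = (y \in D)]) ->
  extra_edge_cut 1 E (cut E D).
Proof.
move=> /set0Pn[x xD] /set0Pn[y]; rewrite inE => yD nbr.
rewrite /extra_edge_cut cut_sub /=; apply/andP; split.
  apply/negP => /connectedP[_ /(_ x y)] /connectD_cut.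
  by rewrite xD (negPf yD).
apply/forall_inP => C /imsetP[u _ ->].
have [v [uv Euv uvD]] := nbr u; apply/card_gt1P; exists u, v; split=> //.
  by rewrite inE connect0.
by rewrite inE connect1 // adjD_cut Euv uvD eqxx.
Qed.

(** * Degrees and edge-degrees *)

Lemma degree_neighbors E x :
  simple_graph E -> degree E x = #|[set y | adj E x y]|.
Proof.
move=> sE; have inj : injective (fun y => [set x; y]).
  move=> y z eq_yz; have := set22 x y; rewrite eq_yz !inE.
  case/orP=> /eqP // y_x; have := set22 x z.
  by rewrite -eq_yz y_x !inE orbb => /eqP.
rewrite -(card_imset _ inj); apply: eq_card => e; rewrite inE.
apply/andP/imsetP => [[eE xe]|[y]]; last first.
  by rewrite inE => xy ->; rewrite set21.
have [u [v [uv e_uv]]] := simple_graph_edge sE eE.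
move: xe; rewrite e_uv !inE => /orP[]/eqP->.
  by exists v; rewrite // inE /adj -e_uv.
by exists u; [rewrite inE adj_sym /adj -e_uv | rewrite setUC].
Qed.

Lemma degree_leq1 E x y z :
  simple_graph E -> degree E x <= 1 -> adj E x y -> adj E x z -> y = z.
Proof.
by move=> sE; rewrite degree_neighbors // => /card_le1_eqP xle xy xz;
   apply: xle; rewrite inE.
Qed.

Lemma degree_leq2 E x y z w :
    simple_graph E -> degree E x <= 2 -> y != z ->
  adj E x y -> adj E x z -> adj E x w -> w \in [set y; z].
Proof.
move=> sE; rewrite degree_neighbors // => x2 yz xy xz xw.
suff -> : [set y; z] = [set u | adj E x u] by rewrite inE.
by apply/eqP; rewrite eqEcard cards2 yz x2 subUset !sub1set !inE xy xz.
Qed.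

Lemma degree_gt0 E x y : adj E x y -> 0 < degree E x.
Proof.
by move=> xy; apply/card_gt0P; exists [set x; y]; rewrite inE set21 andbT.
Qed.

Lemma edge_degree2 E x y :
  x != y -> edge_degree E [set x; y] = degree E x + degree E y - 2.
Proof. by move=> xy; rewrite /edge_degree big_setU1 ?inE // big_set1. Qed.

(** Inclusion-exclusion: [xy] is the only edge at both [x] and [y], and the only edge at either that
    does not cross. *)
Lemma card_cut_edge E x y :
    simple_graph E -> adj E x y ->
  #|cut E [set x; y]| = edge_degree E [set x; y].
Proof.
move=> sE xy; have nxy := adj_neq sE xy; rewrite edge_degree2 //.
set Ex := [set e in E | x \in e]; set Ey := [set e in E | y \in e].
have sub_edge e : e \in E -> (e \subset [set x; y]) = (e == [set x; y]).
  by move=> /(forall_inP sE)/eqP e2; rewrite eqEcard e2 cards2 nxy andbT.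
have -> : cut E [set x; y] = (Ex :|: Ey) :\ [set x; y].
  apply/setP => e; rewrite !inE.
  have [eE|] := boolP (e \in E); last by rewrite andbF.
  rewrite sub_edge // subsetC subUset !sub1set !inE negb_and !negbK.
  by rewrite /=.
have ExIy : Ex :&: Ey = [set [set x; y]].
  apply/setP => e; rewrite !inE; apply/idP/eqP => [|->].
    case/andP=> /andP[eE xe] /andP[_ ye]; apply/esym/eqP.
    rewrite eqEcard subUset !sub1set xe ye cards2 nxy.
    by rewrite (eqP (forall_inP sE e eE)).
  by rewrite set21 set22 !andbT andbb.
have := cardsUI Ex Ey; rewrite ExIy cards1 (cardsD1 [set x; y] (_ :|: _)).
rewrite !inE !eqxx orbT !andbT orbb (_ : [set x; y] \in E) //=.
by rewrite /degree -/Ex -/Ey => <-; rewrite addnC addnA addKn.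
Qed.

(** * 1-extra cuts with at most [xi] edges *)

Lemma connected_neighbor E x :
  connected E -> 1 < #|T| -> exists y, adj E x y.
Proof.
move=> /connectedP[_ conn] T1.
have [y yx] : exists y, y != x.
  by apply/existsP; apply: contraTT T1 => /existsPn eq_x;
     rewrite -leqNgt; apply/card_le1_eqP => u v _ _;
     move: (eq_x u) (eq_x v); rewrite !negbK => /eqP-> /eqP->.
have /connectP[[|z p] /=] := conn x y.
  by move=> _ y_x; rewrite y_x eqxx in yx.
by case/andP=> xz _ _; exists z.
Qed.

Lemma connected_closed E D x :
    connected E -> x \in D -> (forall u v, u \in D -> adj E u v -> v \in D) ->
  D = setT.
Proof.
move=> /connectedP[_ conn] xD cl; apply/setP => y; rewrite inE.
have /connectP[p + ->] := conn x y.
by elim: p x xD => //= u p IH x xD /andP[xu]; apply/IH/cl/xu.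
Qed.

(** Cut around [x] and its pendant neighbours: every crossing edge contains [x], and [xy] does not
    cross, so fewer than [degree E x] edges are cut. *)
Lemma pendant_cut E x y :
    simple_graph E -> connected E -> 1 < #|T| -> adj E x y -> degree E y <= 1 ->
    (exists2 v, v != x & 1 < degree E v) ->
  exists2 F, extra_edge_cut 1 E F & #|F| <= edge_degree E [set x; y].
Proof.
move=> sE conn T1 xy y1 [v vx v2].
pose D := x |: [set u | adj E x u && (degree E u <= 1)].
have xD : x \in D by rewrite setU11.
have leafD u w : u \in D -> u != x -> adj E u w -> w = x.
  rewrite !inE => /orP[->//|/andP[xu u1]] _ uw.
  by apply: degree_leq1 sE u1 uw _; rewrite adj_sym.
have yD : y \in D by rewrite !inE xy y1 orbT.
exists (cut E D).
  apply: extra_cut1; first by apply/set0Pn; exists x.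
    by apply/set0Pn; exists v; rewrite !inE (negPf vx) /= leqNgt v2 andbF.
  move=> u; suff [w uw uwD] : exists2 w, adj E u w & (u \in D) = (w \in D).
    by exists w; split=> //; apply: adj_neq uw.
  have [->|ux] := eqVneq u x; first by exists y; rewrite // xD yD.
  have [w uw] := connected_neighbor u conn T1.
  have [uD|uD] := boolP (u \in D).
    by exists w; rewrite // (leafD u w) ?xD.
  (* Were all neighbours of [u] in [D], they would equal [x], as the other vertices of [D] are
     adjacent to [x] alone; then [u] would be pendant at [x], hence in [D]. *)
  have [|/existsPn nbr] := boolP [exists w, adj E u w && (w \notin D)].
    by case/existsP=> t /andP[ut /negPf tD]; exists t.
  have nbrx t : adj E u t -> t = x.
    move=> ut; have := nbr t; rewrite ut negbK => tD.
    have [//|tx] := eqVneq t x.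
    have ux' : u = x by apply: (leafD t) => //; rewrite adj_sym.
    by rewrite ux' eqxx in ux.
  have xu : adj E x u by rewrite adj_sym -(nbrx w uw).
  case/negP: uD; rewrite !inE (negPf ux) xu degree_neighbors //=.
  apply/card_le1_eqP => a b.
  by rewrite !inE => /nbrx-> /nbrx->.
rewrite edge_degree2 ?(adj_neq sE xy) //.
have : #|cut E D| < degree E x.
  apply/proper_card/properP; split; last first.
    exists [set x; y]; first by rewrite inE set21 andbT.
    by rewrite inE subUset !sub1set xD yD andbF.
  apply/subsetP => e eD; have eE := subsetP (cut_sub E D) e eD.
  rewrite inE eE /=.
  have [a [b [ab e_ab]]] := simple_graph_edge sE eE.
  have ab_x a' b' : adj E a' b' -> a' \in D -> b' \notin D -> a' = x.
    move=> ab' aD; have [//|a'x] := eqVneq a' x.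
    by rewrite (leafD a' b') ?xD.
  have Eab : adj E a b by rewrite /adj -e_ab.
  have := ab_x a b Eab; have := ab_x b a; rewrite adj_sym => /(_ Eab).
  have := eD; rewrite inE eE e_ab !subUset !sub1set ![_ \in ~: D]in_setC.
  rewrite in_set2; case: (a \in D); case: (b \in D) => //= _ xb xa.
    by rewrite xa ?eqxx.
  by rewrite xb ?eqxx ?orbT.
have := degree_gt0 (_ : adj E y x); rewrite adj_sym => /(_ xy); lia.
Qed.

(* The cut around an edge [xy] of minimum edge-degree works unless some other
   vertex [z] has all its neighbours in [{x, y}]; by minimality [xyz] is then the
   whole graph, or one of [x] and [y] is a pendant vertex. *)
Lemma extra_cut1_leq_xi E :
    simple_graph E -> connected E -> 3 < #|T| ->
    (forall x, exists2 v, v != x & 1 < degree E v) ->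
  exists2 F, extra_edge_cut 1 E F & #|F| <= xi E.
Proof.
move=> sE conn T4 nostar.
have T1 : 1 < #|T| by lia.
have E0 : E != set0.
  have /card_gt0P[x0 _] : 0 < #|T| by lia.
  have [v _ v1] := nostar x0; rewrite -card_gt0.
  by have := degree_leq_edges E v; lia.
have [e eE e_min] := xi_attained sE E0.
have [x [y [nxy e_xy]]] := simple_graph_edge sE eE.
rewrite {e}e_xy in eE e_min; have xy : adj E x y by [].
have [/existsP[z /andP[ze /forallP zN]]|/existsPn nz] :=
    boolP [exists z, (z \notin [set x; y])
                  && [forall w, adj E z w ==> (w \in [set x; y])]]; last first.
  exists (cut E [set x; y]); last by rewrite card_cut_edge ?e_min.
  apply: extra_cut1; first by apply/set0Pn; exists x; rewrite set21.
    rewrite -card_gt0; have := cardsC [set x; y]; rewrite cards2; lia.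
  move=> z; suff [w zw zwD] :
      exists2 w, adj E z w & (z \in [set x; y]) = (w \in [set x; y]).
    by exists w; split=> //; apply: adj_neq zw.
  have [|zD] := boolP (z \in [set x; y]).
    case/set2P=> ->; first by exists y; rewrite // set22.
    by exists x; rewrite 1?adj_sym // set21.
  have := nz z; rewrite zD /= negb_forall => /existsP[w].
  by rewrite negb_imply => /andP[zw /negPf wD]; exists w.
have [w zw] := connected_neighbor z conn T1.
wlog w_x : x y eE e_min nxy xy ze zN / w = x => [wlog_x|].
  have := zN w; rewrite zw !inE => /orP[]/eqP w_; first exact: (wlog_x x y).
  by apply: (wlog_x y x) => //;
    rewrite 1?[[set y; x]]setUC // 1?eq_sym // adj_sym.
move: zw; rewrite {w}w_x => zx.
(* Minimality of [xy] against the edge [zu]: replacing [v] by [z] cannot lower the edge-degree. *)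
have dle u v : [set u; v] = [set x; y] -> u != v -> adj E z u ->
    degree E v <= degree E z.
  move=> uv_xy nuv zu.
  have := xi_leq (_ : [set z; u] \in E) => /(_ zu).
  rewrite -e_min -uv_xy !edge_degree2 ?(adj_neq sE zu) //.
  have uv : adj E u v by rewrite /adj uv_xy.
  have vu : adj E v u by rewrite adj_sym.
  have := degree_gt0 uv; have := degree_gt0 vu; have := degree_gt0 zu; lia.
have yz1 : degree E y <= degree E z by apply: (dle x).
(* If [z] misses [y], then [z] is pendant at [x], and by [yz1] so is [y]. *)
have [zy|zy] := boolP (adj E z y); last first.
  rewrite -e_min; apply: pendant_cut => //; apply: leq_trans yz1 _.
  rewrite degree_neighbors //; apply/card_le1_eqP => a b; rewrite !inE.
  have zNx t : adj E z t -> t = x.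
    move=> zt; have := zN t; rewrite zt !inE => /orP[]/eqP // t_y.
    by rewrite -t_y zt in zy.
  by move=> /zNx-> /zNx->.
have z2 : degree E z <= 2.
  rewrite degree_neighbors //.
  apply: leq_trans (_ : #|[set x; y]| <= 2); last by rewrite cards2 nxy.
  apply/subset_leq_card/subsetP => t; rewrite inE => zt.
  by have := zN t; rewrite zt.
have x2 : degree E x <= 2.
  by apply: leq_trans z2; apply: (dle y); rewrite 1?setUC // eq_sym.
have y2 := leq_trans yz1 z2.
have [nxz nyz] : x != z /\ y != z.
  by apply/andP; rewrite ![_ == z]eq_sym -negb_or -in_set2.
(* The triangle [xyz] has all degrees at most two, so no edge leaves it, against [3 < #|T|]. *)
have : [set x; y; z] = setT.
  apply: (@connected_closed E _ x) => // [|u v]; first by rewrite !inE eqxx.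
  have [yx xz yz] : [/\ adj E y x, adj E x z & adj E y z].
    by split; rewrite adj_sym.
  rewrite !inE -orbA => /or3P[]/eqP-> uv.
  - by case/set2P: (degree_leq2 sE x2 nyz xy xz uv) => ->; rewrite eqxx ?orbT.
  - by case/set2P: (degree_leq2 sE y2 nxz yx yz uv) => ->; rewrite eqxx ?orbT.
  - by have := zN v; rewrite uv !inE /= => ->.
move=> all_xyz; have := leq_of_leqif (leq_card_setU [set x; y] [set z]).
by rewrite all_xyz cardsT cards2 nxy cards1 leqNgt T4.
Qed.

(** * Small cuts after a deletion *)

(** A connected side with two vertices is an edge, whose edge-degree counts the cut. *)
Lemma bond_pair E D :
  simple_graph E -> bond E D -> #|D| = 2 -> xi E <= #|cut E D|.
Proof.
move=> sE bD /eqP/cards2P[x [y [nxy D_xy]]].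
have xD : x \in D by rewrite D_xy set21.
suff xy : adj E x y by rewrite D_xy card_cut_edge // xi_leq.
have /connectP[[|z p] /=] : connect (adj (E :\: cut E D)) x y.
- by apply: bD; rewrite D_xy set21 set22.
- by move=> _ y_x; rewrite y_x eqxx in nxy.
rewrite adjD_cut xD => /andP[/andP[xz]].
rewrite {1}D_xy eq_sym eqb_id => /set2P[] z_ _ _; last by rewrite -z_.
by have := adj_neq sE xz; rewrite z_ eqxx.
Qed.

Lemma mem_components_bond E D x :
  bond E D -> x \in D -> D \in components (E :\: cut E D).
Proof.
by move=> bD xD; apply/imsetP; exists x; rewrite ?bond_component ?xD.
Qed.

Lemma extra_cut1_deletion E F F1 :
    simple_graph E -> F \subset E -> connected (E :\: F) ->
    xi (E :\: F) + #|F| < lambda 2 E -> extra_edge_cut 1 (E :\: F) F1 ->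
  xi (E :\: F) <= #|F1| /\
  (#|F1| <= xi (E :\: F) ->
     [exists C in components ((E :\: F) :\: F1), #|C| == 2]).
Proof.
set H := E :\: F => sE FE conn lt_l2 F1cut.
have HE : H \subset E by apply: subsetDl.
have sH := simple_graphS HE sE.
have [D [D1 DC1 bD DF1]] := extra_cut_bond sH conn F1cut.
have le_cut := subset_leq_card DF1.
(* If a side has two vertices, a cut [F1] of at most [xi H] edges coincides with the bond and leaves
   that side as a component. *)
have pair C : bond H C -> cut H C = cut H D -> #|C| = 2 -> xi H <= #|F1| /\
    (#|F1| <= xi H -> [exists C in components (H :\: F1), #|C| == 2]).
  move=> bC CD C2; have := bond_pair sH bC C2; rewrite CD => xi_le.
  split=> [|F1_xi]; first exact: leq_trans le_cut.
  have -> : F1 = cut H C.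
    by apply/eqP; rewrite eq_sym CD eqEcard DF1 (leq_trans F1_xi).
  have /card_gt0P[x xC] : 0 < #|C| by rewrite C2.
  by apply/exists_inP; exists C; rewrite ?C2 ?(mem_components_bond bC xC).
have [D2|D2] := eqVneq #|D| 2; first exact: (pair D).
have [DC2|DC2] := eqVneq #|~: D| 2.
  by apply: (pair (~: D)) => //; [apply: bondC | apply: cutC].
have D3 : 2 < #|D| by lia.
have DC3 : 2 < #|~: D| by lia.
(* With both sides larger, restoring [F] yields a 2-extra cut of [E]; hence [#|F1|] exceeds [xi H]
   and the second claim is vacuous. *)
have := lambda_leq (bond_extra_cut D3 DC3 (bondS HE bD)).
have : #|cut E D| <= #|cut H D :|: F|.
  by apply/subset_leq_card/subsetP => e; rewrite !inE; case: (e \in F) => //=;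
     rewrite ?orbT ?orbF.
have := leq_of_leqif (leq_card_setU (cut H D) F); lia.
Qed.

Lemma super_lambda'_deletion E F :
    simple_graph E -> F \subset E -> connected (E :\: F) -> 3 < #|T| ->
    (forall x, exists2 v, v != x & 1 < degree (E :\: F) v) ->
    xi (E :\: F) + #|F| < lambda 2 E ->
  super_lambda' (E :\: F).
Proof.
move=> sE FE conn T4 nostar lt_l2.
have sH := simple_graphS (subsetDl E F) sE.
have [F0 F0cut F0xi] := extra_cut1_leq_xi sH conn T4 nostar.
have low F1 := extra_cut1_deletion (F1 := F1) sE FE conn lt_l2.
have lambda_xi : lambda 1 (E :\: F) = xi (E :\: F).
  apply/eqP; rewrite eqn_leq (leq_trans (lambda_leq F0cut)) //=.
  apply: leq_lambda => [|F1 /low[]//].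
  (* The default value of [lambda] is bounded through [F0], a set of at least [xi] edges. *)
  apply: leq_trans (low F0 F0cut).1 _.
  by apply: subset_leq_card; case/and3P: F0cut.
apply/and3P; split; last 1 first.
- apply/forallP => F1; apply/implyP => /andP[F1cut /eqP F1_l].
  by apply: (low F1 F1cut).2; rewrite F1_l lambda_xi.
- by apply/andP; split=> //; apply/existsP; exists F0.
- by rewrite lambda_xi.
Qed.

(** * Connectivity and degrees after few deletions *)

Lemma xi_geq_min_degree E :
  simple_graph E -> E != set0 -> (min_degree E).*2 - 2 <= xi E.
Proof.
move=> sE /xi_attained[]// e /(simple_graph_edge sE)[x [y [nxy ->]]] <-.
rewrite edge_degree2 //; have := min_degree_leq E x.
have := min_degree_leq E y; lia.
Qed.

Lemma card_cut1 E x : simple_graph E -> #|cut E [set x]| = degree E x.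
Proof.
move=> sE; apply: eq_card => e; rewrite !inE.
have [eE|//] := boolP (e \in E); rewrite subsetC sub1set inE negbK /=.
rewrite andb_idl // => _; apply/negP => /subset_leq_card.
by rewrite cards1 (eqP (forall_inP sE e eE)).
Qed.

Lemma connected_deletion E F :
    simple_graph E -> connected E -> lambda 1 E = xi E ->
    F \subset E -> #|F| < min_degree E -> 1 < min_degree E ->
  connected (E :\: F).
Proof.
move=> sE conn l_xi FE F_lt d1; apply/negPn/negP => disc.
have /card_gt0P[x0 _] : 0 < #|T| by case/connectedP: conn.
have E0 : E != set0.
  rewrite -card_gt0; have := degree_leq_edges E x0.
  have := min_degree_leq E x0; lia.
have Fcut : extra_edge_cut 0 E F.
  apply/and3P; split=> //; apply/forall_inP => C /imsetP[x _ ->].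
  by apply/card_gt0P; exists x; rewrite inE connect0.
have [D [D0 DC0 bD /subset_leq_card le_F]] := extra_cut_bond sE conn Fcut.
have one C : cut E C = cut E D -> #|C| = 1 -> False.
  move=> CD /eqP/cards1P[x C_x]; move: le_F; rewrite -CD C_x card_cut1 //.
  have := min_degree_leq E x; lia.
have [/one|D1] := eqVneq #|D| 1; first exact.
have [/one|DC1] := eqVneq #|~: D| 1; first by apply; apply: cutC.
have D2 : 1 < #|D| by lia.
have DC2 : 1 < #|~: D| by lia.
(* The bond has at least [xi E], hence [2 * min_degree E - 2] edges, which is at least
   [min_degree E] because of [d1]. *)
have := lambda_leq (bond_extra_cut D2 DC2 bD).
have := xi_geq_min_degree sE E0; lia.
Qed.

(* A vertex [v] of degree at most [1] after the deletion of fewer than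
   [min_degree E] edges lies on all the deleted edges, so there are at most two. *)
Lemma not_star_deletion E F x :
    simple_graph E -> F \subset E -> 3 < #|T| ->
    #|F| < min_degree E -> 1 < min_degree E ->
  exists2 v, v != x & 1 < degree (E :\: F) v.
Proof.
move=> sE FE T4 F_lt d1.
have [/existsP[v /andP[vx v2]]|/existsPn star] :=
  boolP [exists v, (v != x) && (1 < degree (E :\: F) v)]; first by exists v.
have leaf v : v != x -> degree (E :\: F) v <= 1.
  by move=> vx; have := star v; rewrite vx -leqNgt.
have allF v e : v != x -> e \in F -> v \in e.
  move=> /leaf v1 eF.
  set Fv := [set e in F | v \in e].
  have : degree E v <= degree (E :\: F) v + #|Fv|.
    apply: leq_trans (leq_card_setU _ _); apply/subset_leq_card/subsetP => f.
    by rewrite !inE => /andP[-> ->]; case: (f \in F).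
  have := min_degree_leq E v => dv dv'.
  have FvF : Fv \subset F by apply/subsetP => f; rewrite inE => /andP[].
  (* At least [min_degree E - 1] deleted edges contain [v], and [F] has no more edges than that. *)
  have /eqP Fv_F : Fv == F by rewrite eqEcard FvF; lia.
  by move: eF; rewrite -Fv_F inE => /andP[].
have [F0|[e eF]] := set_0Vmem F.
  have /card_gt0P[v] : 0 < #|[set~ x]| by rewrite cardsC1; lia.
  rewrite !inE => /leaf; rewrite F0 setD0 => v1.
  by have := min_degree_leq E v; lia.
have : #|[set~ x]| <= #|e|.
  by apply/subset_leq_card/subsetP => v; rewrite !inE => /allF; apply.
rewrite cardsC1 (eqP (forall_inP sE e (subsetP FE e eF))); lia.
Qed.

(** * Reduction of persistence to an inequality on [xi] *)

Lemma lambda_connected_card h E :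
  simple_graph E -> lambda_connected h E -> h.+1.*2 <= #|T|.
Proof.
move=> sE /andP[conn /existsP[F /(extra_cut_bond sE conn)[D [D1 DC1 _ _]]]].
by have := cardsC D; lia.
Qed.

Lemma rho'_geq E m :
    simple_graph E -> lambda_connected 2 E -> super_lambda' E ->
    m < min_degree E ->
    (forall F, F \subset E -> F != set0 -> #|F| <= m ->
       connected (E :\: F) -> xi (E :\: F) + #|F| < lambda 2 E) ->
  m <= rho' E.
Proof.
move=> sE l2 super m_lt lt_l2.
have T6 := lambda_connected_card sE l2.
have conn : connected E by case/andP: l2.
have l_xi : lambda 1 E = xi E by case/and3P: super => _ /eqP.
have m_E : m < #|E|.+1.
  have /card_gt0P[x _] : 0 < #|T| by lia.
  have := min_degree_leq E x; have := degree_leq_edges E x; lia.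
apply: (leq_bigmax_cond (Ordinal m_E)).
apply/forallP => F; apply/implyP => /andP[FE F_m].
(* Empty [F] is the hypothesis [super]; a nonempty one forces [1 < min_degree E]. *)
have [->|F0] := eqVneq F set0; first by rewrite setD0.
have F1 : 0 < #|F| by rewrite card_gt0.
have F_lt : #|F| < min_degree E := leq_ltn_trans F_m m_lt.
have d1 : 1 < min_degree E := leq_ltn_trans F1 F_lt.
have connH := connected_deletion sE conn l_xi FE F_lt d1.
apply: super_lambda'_deletion => // [|x|]; first by lia.
  by apply: not_star_deletion => //; lia.
exact: lt_l2.
Qed.

(** * The minimum edge-degree after a deletion *)

Lemma edge_degreeS E H e : E \subset H -> edge_degree E e <= edge_degree H e.
Proof.
move=> /subsetP EH; apply/leq_sub2r/leq_sum => x _.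
by apply/subset_leq_card/subsetP => f; rewrite !inE => /andP[/EH-> ->].
Qed.

(** Some edge of minimum edge-degree survives, and deletion never raises an edge-degree. *)
Lemma xi_deletion_leq E F : #|F| < eta E -> xi (E :\: F) <= xi E.
Proof.
move=> F_lt; have /subsetPn[e] :
    ~~ ([set e in E | edge_degree E e == xi E] \subset F).
  by apply: contraTN F_lt => /subset_leq_card; rewrite -leqNgt.
rewrite inE => /andP[eE /eqP<-] eF.
apply: leq_trans (edge_degreeS e (subsetDl E F)).
by apply: xi_leq; rewrite inE eF.
Qed.

(** An end [u] of a deleted edge keeps a neighbour [w] by connectedness; [uw] had edge-degree [xi E]
    and [u] has lost an edge. *)
Lemma xi_deletion_lt E F :
    simple_graph E -> edge_regular E -> F \subset E -> F != set0 ->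
    1 < #|T| -> connected (E :\: F) ->
  xi (E :\: F) < xi E.
Proof.
move=> sE /forall_inP reg FE /set0Pn[f fF] T1 conn.
have HE := subsetDl E F; have sH := simple_graphS HE sE.
have fE := subsetP FE f fF.
have [u [v [nuv f_uv]]] := simple_graph_edge sE fE.
have [w uw] := connected_neighbor u conn T1.
have nuw := adj_neq sH uw.
have Euw : adj E u w := subsetP HE _ uw.
apply: leq_ltn_trans (xi_leq uw) _; rewrite -(eqP (reg _ Euw)) !edge_degree2 //.
have du : degree (E :\: F) u < degree E u.
  apply/proper_card/properP; split.
    by apply/subsetP => e; rewrite !inE => /andP[/andP[_ ->] ->].
  by exists f; rewrite !inE ?fE ?fF // f_uv set21.
have dw : degree (E :\: F) w <= degree E w.
  apply/subset_leq_card/subsetP => e.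
  by rewrite !inE => /andP[/andP[_ ->] ->].
(* Both remaining degrees are positive, so the truncated [- 2] preserves strictness. *)
have := degree_gt0 uw; have := degree_gt0 (_ : adj (E :\: F) w u).
rewrite adj_sym => /(_ uw); lia.
Qed.

End Graph.

Theorem theorem2p4 (T : finType) (E : {set {set T}})
    (hE : simple_graph E)
    (hl2 : lambda_connected 2 E)
    (hsuper : super_lambda' E) :
  (min_degree E <= eta E ->
    (Num.min ((lambda 2 E)%:Z - (xi E)%:Z - 1) ((min_degree E)%:Z - 1)
       <= (rho' E)%:Z)%R) /\
  (edge_regular E ->
    (Num.min ((lambda 2 E)%:Z - (xi E)%:Z) ((min_degree E)%:Z - 1)
       <= (rho' E)%:Z)%R).
Proof.
have T6 := lambda_connected_card hE hl2.
have T1 : 1 < #|T| by lia.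
(* On failure [rho'_geq] would apply to [(rho' E).+1]. Its strict inequality comes from the extra
   [- 1] in (i), and from the drop of [xi] in (ii). *)
split=> [d_eta | reg]; rewrite leNgt; apply/negP => rho_lt.
  have : (rho' E).+1 <= rho' E.
    apply: rho'_geq => // [|F FE F0 F_le conn]; first by lia.
    by have := @xi_deletion_leq T E F; lia.
  by rewrite ltnn.
have : (rho' E).+1 <= rho' E.
  apply: rho'_geq => // [|F FE F0 F_le conn]; first by lia.
  by have := xi_deletion_lt hE reg FE F0 T1 conn; lia.
by rewrite ltnn.
Qed.
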